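(* Let $L(m,n)=3\frac{m^2+m}{2}+2nm+n^2+n$. For every non-negative integer $N$, \[ \sum_{m,n\ge0}q^{L(m,n)}{2N-2m-2n \brack m}_q{N-m-n+\lfloor\frac n2\rfloor \brack \lfloor\frac n2\rfloor}_{q^4}=\sum_{m,n\ge0}q^{m^2+n^2+n}{N-m\brack n}_{q^2}{n\brack m}_{q^2}, \] \[ \sum_{m,n\ge0}q^{L(m,n)+2m+2n+1}{2N-2m-2n-2 \brack m}_q{N-m-n-1+\lfloor\frac n2\rfloor \brack \lfloor\frac n2\rfloor}_{q^4}=\sum_{m,n\ge0}q^{m^2+n^2+3n+1}{N-m-1\brack n}_{q^2}{n\brack m}_{q^2}. \]
   Context: For integers $A,B$ and base $p$, ${A\brack B}_p=\frac{(p;p)_A}{(p;p)_B(p;p)_{A-B}}$ if $0\le B\le A$ and $0$ otherwise, where $(a;p)_j=\prod_{i=0}^{j-1}(1-ap^i)$. $\lfloor\cdot\rfloor$ is the floor function. *)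

(* Defs.v *)
From HB Require Import structures.
From mathcomp Require Import all_boot all_order all_algebra finmap.
From mathcomp Require Import boolp classical_sets functions cardinality fsbigop.
From mathcomp Require Import zify.

Set Implicit Arguments.
Unset Strict Implicit.
Unset Printing Implicit Defensive.

Import Order.TTheory GRing.Theory Num.Theory.
Local Open Scope ring_scope.
Local Open Scope classical_set_scope.

(* The q-Pochhammer symbol (a; p)_j. *)
Definition qpoch (F : fieldType) (a p : F) (j : nat) : F :=
  \prod_(i < j) (1 - a * p ^+ i).

(* The quotient below is division in F, so it has its intended meaning when
   p ^+ k != 1 for all k > 0. This holds for a power p = q ^+ e, e > 0, of an
   indeterminate q (F a field of rational functions), and for 0 < |q| < 1.
   A and B are integers: a negative A or B, or B > A, gives 0. The absolute
   values only convert nonnegative integers to nat. *)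
Definition qbin (F : fieldType) (A B : int) (p : F) : F :=
  if (0 <= B) && (B <= A) then
    qpoch p p `|A|%N / (qpoch p p `|B|%N * qpoch p p `|A - B|%N)
  else 0.

(* m ^ 2 + m is even, so the truncated division is exact. *)
Definition L (m n : nat) : nat :=
  (3 * ((m ^ 2 + m) %/ 2) + 2 * n * m + n ^ 2 + n)%N.

Lemma qbin_small (F : fieldType) (A B : int) (p : F) :
  A < B -> qbin A B p = 0.
Proof. by move=> AB; rewrite /qbin (lt_geF AB) andbF. Qed.

(* \sum_(x \in A) is 0 by convention when the support is infinite. The next
   three lemmas show that this does not happen for the double sums considered:
   a summand vanishes as soon as m + n exceeds the bound M. *)
Lemma sum_natnatE (V : nmodType) (K : nat) (f : nat * nat -> V) :
  (forall m n, (K < m + n)%N -> f (m, n) = 0) ->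
  \sum_(x \in [set: nat * nat]) f x =
  \sum_(m < K.+1) \sum_(n < K.+1) f (m : nat, n : nat).
Proof.
move=> f0; pose s := [seq (m, n) | m <- iota 0 K.+1, n <- iota 0 K.+1].
have us : uniq s by apply: allpairs_uniq; rewrite ?iota_uniq // => -[? ?] [].
rewrite (@fsbigE _ _ _ _ _ s) //; last first.
  move=> [m n] _ /negP ns; apply: f0; rewrite ltnNge; apply/negP => le_mnK.
  apply: ns.
  by apply: allpairs_f; rewrite mem_iota; lia.
rewrite big_mkcond /= (eq_bigr f); last by move=> i _; rewrite in_setT.
rewrite big_allpairs -[iota 0 K.+1]/(index_iota 0 K.+1) big_mkord.
by apply: eq_bigr => m _; rewrite big_mkord.
Qed.

Lemma lhs_summand0 (F : fieldType) (M : int) (m n : nat) (c p : F) :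
  M < m%:Z + n%:Z ->
  c * qbin (M - m%:Z - n%:Z + (n./2)%:Z) (n./2)%:Z p = 0.
Proof. by move=> h; rewrite qbin_small ?mulr0 //; lia. Qed.

Lemma rhs_summand0 (F : fieldType) (M : int) (m n : nat) (c p r : F) :
  M < m%:Z + n%:Z ->
  c * qbin (M - m%:Z) n%:Z p * r = 0.
Proof. by move=> h; rewrite qbin_small ?mulr0 ?mul0r //; lia. Qed.

(* Main.v *)
(** Insert a weight z^(m+n) on the left and z^n on the right. Both sides then
satisfy P_N = (1 + z q^(2N)) P_(N-1) + z q^(2N-1) P_(N-2) and agree for N <= 1;
z = 1 gives the first identity, and z = q^2 with N - 1 in place of N gives the
second one divided by q. On the right the recurrence is two applications of the
q-Pascal rules. On the left, split by the parity of n, it is a linear combination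
of twelve q-Pascal relations between sums of the same shape. These use negative
powers of q; for q = 0 only the terms with m = n = 0 survive. *)

Require Import Defs.
From mathcomp Require Import all_boot all_order all_algebra.
From mathcomp Require Import classical_sets fsbigop.
From mathcomp Require Import zify ring.

Import GRing.Theory Num.Theory.
Local Open Scope ring_scope.
Local Open Scope classical_set_scope.

(** * q-Pascal rules for Gaussian binomials with integer top *)

Section QBinomial.
Context {F : fieldType} (p : F).
Hypothesis hp : forall k : nat, (0 < k)%N -> p ^+ k != 1.

Lemma qpochS k : qpoch p p k.+1 = qpoch p p k * (1 - p ^+ k.+1).
Proof. by rewrite /qpoch big_ord_recr /= -exprS. Qed.

Lemma qpoch_neq0 k : qpoch p p k != 0.
Proof.
apply/prodf_neq0 => i _.
by rewrite -exprS subr_eq0 eq_sym hp.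
Qed.

Lemma qbin_addn (a b : nat) :
  qbin (a + b)%N%:Z b%:Z p = qpoch p p (a + b)%N / (qpoch p p b * qpoch p p a).
Proof.
rewrite /qbin ifT; last by lia.
have -> : `|((a + b)%N%:Z - b%:Z)%R|%N = a by lia.
by [].
Qed.

Lemma qbin_sym (a b : nat) :
  qbin (a + b)%N%:Z b%:Z p = qbin (b + a)%N%:Z a%:Z p.
Proof. by rewrite !qbin_addn addnC [qpoch p p b * _]mulrC. Qed.

Lemma qbin_diag (b : nat) : qbin b%:Z b%:Z p = 1.
Proof.
rewrite -[X in qbin X%:Z]add0n qbin_addn add0n /qpoch big_ord0 mulr1.
by rewrite divff ?qpoch_neq0.
Qed.

Lemma qbin0 (a : int) : 0 <= a -> qbin a 0 p = 1.
Proof.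
case: a => // a _; have := qbin_addn a 0; rewrite addn0 => ->.
by rewrite /qpoch big_ord0 mul1r divff ?qpoch_neq0.
Qed.

(** The bottom is a successor so that every integer top is allowed: for [a <= b] all three binomials
    vanish, whereas with bottom 0 the rule would fail at top 0. *)
Lemma qbin_pascal (a : int) (b : nat) :
  qbin a b.+1%:Z p
  = qbin (a - 1) b.+1%:Z p + p ^ (a - b.+1%:Z) * qbin (a - 1) b%:Z p.
Proof.
have [lt_ab|] := boolP (a < b.+1%:Z).
  rewrite !(@qbin_small _ _ b.+1%:Z) ?(@qbin_small _ _ b%:Z) ?mulr0 ?addr0 //; lia.
move=> le_ba; have {le_ba} -> : a = (`|a - b.+1%:Z|%N + b.+1)%N%:Z by lia.
case: `|_|%N => [|j].
  rewrite add0n qbin_diag subrr expr0z mul1r.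
  have -> : b.+1%:Z - 1 = b%:Z :> int by lia.
  by rewrite qbin_diag qbin_small ?add0r //; lia.
have -> : (j.+1 + b.+1)%N%:Z - b.+1%:Z = j.+1%:Z by lia.
rewrite -exprnP.
have -> : (j.+1 + b.+1)%N%:Z - 1 = (j + b.+1)%N%:Z by lia.
rewrite !qbin_addn.
have -> : (j + b.+1)%N%:Z = (j.+1 + b)%N%:Z by lia.
rewrite qbin_addn !addSn addnS !qpochS.
have := qpoch_neq0 b; have := qpoch_neq0 j.
have : 1 - p ^+ j.+1 != 0 by rewrite subr_eq0 eq_sym hp.
have : 1 - p ^+ b.+1 != 0 by rewrite subr_eq0 eq_sym hp.
rewrite (_ : (j + b).+2 = j.+1 + b.+1)%N; last by lia.
rewrite exprD.
move: (p ^+ j.+1) (p ^+ b.+1) => v u hu hv hj hb.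
(* With the Pochhammer symbols cancelled, this is [1 - u * v = (1 - v) + v * (1 - u)]. *)
by field; rewrite hu hv hj hb.
Qed.

(** The first rule applied to the complementary bottom, by symmetry. *)
Lemma qbin_pascal' (a : int) (b : nat) :
  qbin a b.+1%:Z p
  = p ^+ b.+1 * qbin (a - 1) b.+1%:Z p + qbin (a - 1) b%:Z p.
Proof.
have [lt_ab|] := boolP (a < b.+1%:Z).
  rewrite !(@qbin_small _ _ b.+1%:Z) ?(@qbin_small _ _ b%:Z) ?mulr0 ?addr0 //; lia.
move=> le_ba; have {le_ba} -> : a = (`|a - b.+1%:Z|%N + b.+1)%N%:Z by lia.
case: `|_|%N => [|j].
  rewrite add0n qbin_diag.
  have -> : b.+1%:Z - 1 = b%:Z :> int by lia.
  by rewrite qbin_diag qbin_small ?mulr0 ?add0r //; lia.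
have -> : (j.+1 + b.+1)%N%:Z - 1 = (j + b.+1)%N%:Z by lia.
rewrite qbin_sym qbin_pascal.
have -> : (b.+1 + j.+1)%N%:Z - j.+1%:Z = b.+1%:Z by lia.
have -> : (b.+1 + j.+1)%N%:Z - 1 = (b + j.+1)%N%:Z by lia.
by rewrite -exprnP (qbin_sym b j.+1) (qbin_sym j b.+1) !addSnnS addrC.
Qed.

End QBinomial.

(** * Tools for summing and regrouping *)

(** Sums a q-Pascal rule: index 0 has no predecessor and is compared separately, and the shift drops
    the last [u], which must therefore vanish. *)
Lemma sum_split_shift (V : nmodType) (M : nat) (t t' u : nat -> V) :
  t 0%N = t' 0%N -> (forall m, t m.+1 = t' m.+1 + u m) -> u M = 0 ->
  \sum_(m < M.+1) t m = \sum_(m < M.+1) t' m + \sum_(m < M.+1) u m.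
Proof.
move=> t0 tS uM.
rewrite big_ord_recl /= t0 [X in _ = X + _]big_ord_recl [X in _ = _ + X]big_ord_recr /=.
rewrite uM addr0 -addrA -big_split /=; congr (_ + _).
by apply: eq_bigr => m _; rewrite tS.
Qed.

Lemma sum_parity (V : nmodType) (K : nat) (f : nat -> V) :
  \sum_(n < K.*2) f n = \sum_(k < K) f k.*2 + \sum_(k < K) f k.*2.+1.
Proof.
elim: K => [|K IH]; first by rewrite !big_ord0 addr0.
by rewrite doubleS !big_ord_recr /= IH -!addrA; congr (_ + _); rewrite addrCA.
Qed.

Lemma triS m : 'C(m.+2, 2) = ('C(m.+1, 2) + m.+1)%N.
Proof. by rewrite binS bin1. Qed.

Lemma regroup (R : comPzRingType) (Z Z1 Z2 Q Q1 Q2 X X' Y Y' : R) :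
  Z = Z1 * Z2 -> Q = Q1 * Q2 -> X = X' -> Y = Y' ->
  Z * Q * X * Y = Z1 * Q1 * (Z2 * Q2 * X' * Y').
Proof. by move=> -> -> -> ->; ring. Qed.

Lemma shift_regroup (R : comPzRingType) (Z Z1 Z2 Q Q0 Q1 Q2 X X' Y Y' : R) :
  Z = Z1 * Z2 -> Q * Q0 = Q1 * Q2 -> X = X' -> Y = Y' ->
  Z * Q * (Q0 * X) * Y = Z1 * Q1 * (Z2 * Q2 * X' * Y').
Proof. by rewrite mulrA -[Z * Q * Q0]mulrA; apply: regroup. Qed.

(** Adds [c] times a known relation to the goal; repeated use turns the goal into a linear
    combination that [ring] can check. *)
Lemma addr_mul_inj {R : pzRingType} (c : R) {a b x y : R} :
  a = b -> x + c * b = y + c * a -> x = y.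
Proof. by move=> ->; apply: addIr. Qed.

Lemma L_bin m n : L m n = (3 * 'C(m.+1, 2) + 2 * n * m + n ^ 2 + n)%N.
Proof. by rewrite /L bin2 -divn2 -(mulnn m) -mulSnr. Qed.

(** * Recurrence for the left-hand side *)

Section Recurrences.
Context {F : fieldType} (q z : F).
Hypothesis hq : forall k : nat, (0 < k)%N -> q ^+ k != 1.
Hypothesis q0 : q != 0.

Lemma expX_neq1 e : (0 < e)%N -> forall k : nat, (0 < k)%N -> (q ^+ e) ^+ k != 1.
Proof. by move=> e0 k k0; rewrite -exprM hq // muln_gt0 e0. Qed.

(* The terms of the left-hand side with n = 2 k even, with the two tops freed to
   A and B and an extra weight q ^ (c m + d k), so that the q-Pascal rules relate
   these sums to one another. Allowing c < 0 is what forces integer exponents. *)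
Definition lhs_term (A B c d : int) (m k : nat) : F :=
  z ^+ (m + 2 * k)
  * q ^ (3 * 'C(m.+1, 2)%:Z + 4 * k%:Z * m%:Z + 4 * k%:Z * k%:Z + 2 * k%:Z
         + c * m%:Z + d * k%:Z)
  * qbin (A - 2 * m%:Z - 4 * k%:Z) m%:Z q
  * qbin (B - m%:Z - k%:Z) k%:Z (q ^+ 4).

Definition lhs_sum (M K : nat) (A B c d : int) : F :=
  \sum_(m < M.+1) \sum_(k < K.+1) lhs_term A B c d m k.

Lemma lhs_term0 A B c d m k : B < m%:Z + 2 * k%:Z -> lhs_term A B c d m k = 0.
Proof. by move=> h; rewrite /lhs_term [qbin _ k%:Z _]qbin_small ?mulr0 //; lia. Qed.

(* The first hypothesis excludes the only place where the q-Pascal rule fails for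
   integer tops, namely 'top = bottom = 0', reached here for m = 0 and A = 4 k. *)
Lemma lhs_sum_pascal M K A B c d A1 A3 B1 e :
  (forall k : nat, A = 4 * k%:Z -> B < 2 * k%:Z) -> B <= M%:Z ->
  A1 = A - 1 -> A3 = A - 3 -> B1 = B - 1 -> e = A + c ->
  lhs_sum M K A B c d
  = lhs_sum M K A1 B c d + z * q ^ e * lhs_sum M K A3 B1 c d.
Proof.
move=> hA hB -> -> -> ->; rewrite /lhs_sum exchange_big /=.
rewrite [in RHS]exchange_big /= [X in _ = _ + _ * X]exchange_big /=.
rewrite mulr_sumr -big_split /=; apply: eq_bigr => k _; rewrite mulr_sumr.
apply: (@sum_split_shift _ M (lhs_term A B c d ^~ k) (lhs_term (A - 1) B c d ^~ k)
         (fun m => z * q ^ (A + c) * lhs_term (A - 3) (B - 1) c d m k)).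
- have [ltB|leB] := boolP (B < 2 * k%:Z); first by rewrite !lhs_term0 //; lia.
  have neA : A != 4 * k%:Z by apply/eqP => /hA; apply/negP.
  rewrite /lhs_term; congr (_ * _ * _).
  have [lt0|le0] := boolP (A - 4 * k%:Z < 0); first by rewrite !qbin_small //; lia.
  by rewrite !qbin0 //; lia.
(* The exponent [A - 3 (m + 1) - 4 k] from q-Pascal cancels the growth [3 (m + 1) + 4 k] of the
   quadratic form, so [c] and [d] do not change. *)
- move=> m; rewrite /lhs_term qbin_pascal // triS mulrDr mulrDl.
  congr (_ + _); first by congr (_ * _ * qbin _ _ _ * qbin _ _ _); lia.
  apply: shift_regroup; last by congr (qbin _ _ _); lia.
  - by rewrite addSn exprS.
  - by rewrite -!expfzDr //; congr (q ^ _); lia.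
  - by congr (qbin _ _ _); lia.
- by rewrite lhs_term0 ?mulr0 //; lia.
Qed.

(** The power of [q] in this rule depends on [m] only and raises [c] by 1; the other part keeps the
    full growth of the exponent, whence [c + 3] and [d + 4]. *)
Lemma lhs_sum_pascal' M K A B c d A1 A3 B1 c1 c3 d4 e :
  (forall k : nat, A = 4 * k%:Z -> B < 2 * k%:Z) -> B <= M%:Z ->
  A1 = A - 1 -> A3 = A - 3 -> B1 = B - 1 ->
  c1 = c + 1 -> c3 = c + 3 -> d4 = d + 4 -> e = c + 3 ->
  lhs_sum M K A B c d
  = lhs_sum M K A1 B c1 d + z * q ^ e * lhs_sum M K A3 B1 c3 d4.
Proof.
move=> hA hB -> -> -> -> -> -> ->; rewrite /lhs_sum exchange_big /=.
rewrite [in RHS]exchange_big /= [X in _ = _ + _ * X]exchange_big /=.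
rewrite mulr_sumr -big_split /=; apply: eq_bigr => k _; rewrite mulr_sumr.
apply: (@sum_split_shift _ M (lhs_term A B c d ^~ k) (lhs_term (A - 1) B (c + 1) d ^~ k)
         (fun m => z * q ^ (c + 3) * lhs_term (A - 3) (B - 1) (c + 3) (d + 4) m k)).
- have [ltB|leB] := boolP (B < 2 * k%:Z); first by rewrite !lhs_term0 //; lia.
  have neA : A != 4 * k%:Z by apply/eqP => /hA; apply/negP.
  rewrite /lhs_term; congr (_ * q ^ _ * _ * _); first by lia.
  have [lt0|le0] := boolP (A - 4 * k%:Z < 0); first by rewrite !qbin_small //; lia.
  by rewrite !qbin0 //; lia.
- move=> m; rewrite /lhs_term qbin_pascal' // (exprnP q m.+1) triS mulrDr mulrDl.
  congr (_ + _).
    rewrite [_ * (q ^ _ * _)]mulrA -[z ^+ _ * _ * q ^ _]mulrA -expfzDr //.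
    by congr (_ * q ^ _ * qbin _ _ _ * qbin _ _ _); lia.
  apply: regroup; last by congr (qbin _ _ _); lia.
  - by rewrite addSn exprS.
  - by rewrite -!expfzDr //; congr (q ^ _); lia.
  - by congr (qbin _ _ _); lia.
- by rewrite lhs_term0 ?mulr0 //; lia.
Qed.

(* Here q-Pascal fails only for k = 0 and m = B, and A < 3 * B makes the other
   q-binomial vanish there. *)
Lemma lhs_sum_pascal_q4 M K A B c d A4 B1 B2 e :
  A < 3 * B -> B <= K%:Z ->
  A4 = A - 4 -> B1 = B - 1 -> B2 = B - 2 -> e = 4 * B + d - 2 ->
  lhs_sum M K A B c d
  = lhs_sum M K A B1 c d + z ^+ 2 * q ^ e * lhs_sum M K A4 B2 c d.
Proof.
move=> hA hB -> -> -> ->; rewrite /lhs_sum.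
rewrite mulr_sumr -big_split /=; apply: eq_bigr => m _; rewrite mulr_sumr.
apply: (@sum_split_shift _ K (lhs_term A B c d m) (lhs_term A (B - 1) c d m)
   (fun k => z ^+ 2 * q ^ (4 * B + d - 2) * lhs_term (A - 4) (B - 2) c d m k)).
- have [ltB|leB] := boolP (B < m%:Z); first by rewrite !lhs_term0 //; lia.
  rewrite /lhs_term.
  have [eqB|neB] := boolP (B == m%:Z); last first.
    by congr (_ * _); rewrite !qbin0 //; try exact: expX_neq1; lia.
  by rewrite [qbin _ m%:Z q]qbin_small ?mulr0 ?mul0r //; lia.
- move=> k; rewrite /lhs_term qbin_pascal; last exact: expX_neq1.
  rewrite mulrDr.
  congr (_ + _); first by congr (_ * _ * qbin _ _ _ * qbin _ _ _); lia.
  rewrite (exprnP q 4) exprz_exp [LHS]mulrACA -[LHS]mulrA [q ^ _ * (_ * _)]mulrA [LHS]mulrA.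
  apply: shift_regroup; last by congr (qbin _ _ _); lia.
  - by rewrite -exprD; congr (z ^+ _); lia.
  - by rewrite -!expfzDr //; congr (q ^ _); lia.
  - by congr (qbin _ _ _); lia.
- by rewrite lhs_term0 ?mulr0 //; lia.
Qed.

(* The second summand collects the odd n = 2 k + 1. *)
Definition lhs_poly (M K : nat) (n : int) : F :=
  lhs_sum M K (2 * n) n 0 0
  + z * q ^+ 2 * lhs_sum M K (2 * n - 2) (n - 1) 2 4.

Lemma lhs_poly_rec M K (n : int) : 2 <= n -> n <= M%:Z -> n <= K%:Z ->
  lhs_poly M K n = (1 + z * q ^ (2 * n)) * lhs_poly M K (n - 1)
                   + z * q ^ (2 * n - 1) * lhs_poly M K (n - 2).
Proof.
move=> n2 nM nK; rewrite /lhs_poly.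
have -> : 2 * (n - 1) - 2 = 2 * n - 4 :> int by lia.
have -> : 2 * (n - 2) - 2 = 2 * n - 6 :> int by lia.
have -> : 2 * (n - 1) = 2 * n - 2 :> int by lia.
have -> : 2 * (n - 2) = 2 * n - 4 :> int by lia.
have -> : n - 1 - 1 = n - 2 :> int by lia.
have -> : n - 2 - 1 = n - 3 :> int by lia.
(* [2 * n - 4] is the least exponent linear in [n] below, so all powers of [q] become monomials in
   [w] and [q] that [ring] can handle. *)
pose G := lhs_sum M K; rewrite -/G; pose w := q ^ (2 * n - 4).
have qw i e : e = 2 * n - 4 + i%:Z -> q ^ e = w * q ^+ i.
  by move=> ->; rewrite expfzDr.
have qww i e : e = (2 * n - 4) * 2 + i%:Z -> q ^ e = w ^+ 2 * q ^+ i.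
  by move=> ->; rewrite expfzDr // -exprz_exp.
rewrite (qw 4%N (2 * n)) ?(qw 3%N (2 * n - 1)); try lia.
have r1 : G (2 * n - 3) (n - 2) (-1) 0 = G (2 * n - 4) (n - 2) (-1) 0
    + z * w * G (2 * n - 6) (n - 3) (-1) 0.
  by apply: lhs_sum_pascal; lia.
have r2 : G (2 * n - 3) (n - 2) 2 4 = G (2 * n - 4) (n - 2) 2 4
    + z * (w * q ^+ 3) * G (2 * n - 6) (n - 3) 2 4.
  by rewrite -(qw 3%N (2 * n - 1)); first apply: lhs_sum_pascal; lia.
have r3 : G (2 * n - 2) (n - 2) 2 4 = G (2 * n - 3) (n - 2) 2 4
    + z * (w * q ^+ 4) * G (2 * n - 5) (n - 3) 2 4.
  by rewrite -(qw 4%N (2 * n)); first apply: lhs_sum_pascal; lia.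
have r4 : G (2 * n - 1) (n - 1) (-1) 0 = G (2 * n - 2) (n - 1) (-1) 0
    + z * (w * q ^+ 2) * G (2 * n - 4) (n - 2) (-1) 0.
  by rewrite -(qw 2%N (2 * n - 2)); first apply: lhs_sum_pascal; lia.
have r5 : G (2 * n - 1) (n - 1) 0 0 = G (2 * n - 2) (n - 1) 0 0
    + z * (w * q ^+ 3) * G (2 * n - 4) (n - 2) 0 0.
  by rewrite -(qw 3%N (2 * n - 1)); first apply: lhs_sum_pascal; lia.
have r6 : G (2 * n) (n - 1) 0 0 = G (2 * n - 1) (n - 1) 0 0
    + z * (w * q ^+ 4) * G (2 * n - 3) (n - 2) 0 0.
  by rewrite -(qw 4%N (2 * n)); first apply: lhs_sum_pascal; lia.
(* At [c = -1], [d = 0] the second rule produces exactly the weights of the even and the odd part: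
   the right sides of [r7] and [r9] are [lhs_poly] at [n - 2] and [n - 1]. *)
have r7 : G (2 * n - 3) (n - 2) (-1) 0 = G (2 * n - 4) (n - 2) 0 0
    + z * q ^+ 2 * G (2 * n - 6) (n - 3) 2 4.
  by rewrite (exprnP q 2); apply: lhs_sum_pascal'; lia.
have r8 : G (2 * n - 2) (n - 2) (-1) 0 = G (2 * n - 3) (n - 2) 0 0
    + z * q ^+ 2 * G (2 * n - 5) (n - 3) 2 4.
  by rewrite (exprnP q 2); apply: lhs_sum_pascal'; lia.
have r9 : G (2 * n - 1) (n - 1) (-1) 0 = G (2 * n - 2) (n - 1) 0 0
    + z * q ^+ 2 * G (2 * n - 4) (n - 2) 2 4.
  by rewrite (exprnP q 2); apply: lhs_sum_pascal'; lia.
have r10 : G (2 * n - 2) (n - 1) (-1) 0 = G (2 * n - 2) (n - 2) (-1) 0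
    + z ^+ 2 * (w ^+ 2 * q ^+ 2) * G (2 * n - 6) (n - 3) (-1) 0.
  by rewrite -(qww 2%N (4 * n - 6)); first apply: lhs_sum_pascal_q4; lia.
have r11 : G (2 * n - 2) (n - 1) 2 4 = G (2 * n - 2) (n - 2) 2 4
    + z ^+ 2 * (w ^+ 2 * q ^+ 6) * G (2 * n - 6) (n - 3) 2 4.
  by rewrite -(qww 6%N (4 * n - 2)); first apply: lhs_sum_pascal_q4; lia.
have r12 : G (2 * n) n 0 0 = G (2 * n) (n - 1) 0 0
    + z ^+ 2 * (w ^+ 2 * q ^+ 6) * G (2 * n - 4) (n - 2) 0 0.
  by rewrite -(qww 6%N (4 * n - 2)); first apply: lhs_sum_pascal_q4; lia.
(* The multipliers were found by linear algebra over the field of rational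
   functions in q, z and q ^ n. *)
apply: (addr_mul_inj (z ^+ 2 * w ^+ 2 * q ^+ 6) r1).
apply: (addr_mul_inj (z * q ^+ 2) r2); apply: (addr_mul_inj (z * q ^+ 2) r3).
apply: (addr_mul_inj (- (z * w * q ^+ 4)) r4); apply: (addr_mul_inj 1 r5).
apply: (addr_mul_inj 1 r6); apply: (addr_mul_inj (- (z ^+ 2 * w ^+ 2 * q ^+ 6)) r7).
apply: (addr_mul_inj (- (z * w * q ^+ 4)) r8); apply: (addr_mul_inj (z * w * q ^+ 4) r9).
apply: (addr_mul_inj (- (z * w * q ^+ 4)) r10); apply: (addr_mul_inj (z * q ^+ 2) r11).
by apply: (addr_mul_inj 1 r12); clearbody G w; ring.
Qed.

Lemma lhs_sum_lt0 M K A B c d : B < 0 -> lhs_sum M K A B c d = 0.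
Proof.
move=> B0; rewrite /lhs_sum !big1 // => m _.
by rewrite big1 // => k _; rewrite lhs_term0 //; lia.
Qed.

Lemma lhs_sum_eq0 M K A c d : 0 <= A -> lhs_sum M K A 0 c d = 1.
Proof.
move=> A0; rewrite /lhs_sum big_ord_recl big_ord_recl /= !big1 ?addr0; first last.
- by move=> k _; rewrite lhs_term0 //= /bump; lia.
- by move=> m _; rewrite big1 // => k _; rewrite lhs_term0 //= /bump; lia.
rewrite /lhs_term /= !qbin0 //; try exact: expX_neq1; try lia.
by rewrite bin_small // !mulr0 !addr0 expr0z muln0 expr0 !mulr1.
Qed.

(** * Recurrence for the right-hand side *)

Definition rhs_term (N : int) (m n : nat) : F :=
  z ^+ n * q ^+ (m ^ 2 + n ^ 2 + n) * qbin (N - m%:Z) n%:Z (q ^+ 2)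
  * qbin n%:Z m%:Z (q ^+ 2).

Definition rhs_poly (M : nat) (N : int) : F :=
  \sum_(m < M.+1) \sum_(n < M.+1) rhs_term N m n.

Lemma rhs_term0 N m n : N < m%:Z + n%:Z -> rhs_term N m n = 0.
Proof. by move=> h; rewrite /rhs_term qbin_small ?mulr0 ?mul0r //; lia. Qed.

Lemma rhs_poly_rec M (N : int) : 1 <= N -> N <= M%:Z ->
  rhs_poly M N = (1 + z * q ^ (2 * N)) * rhs_poly M (N - 1)
                 + z * q ^ (2 * N - 1) * rhs_poly M (N - 2).
Proof.
move=> N1 NM; rewrite mulrDl mul1r -addrA.
(* v m n is what the q-Pascal rule in the top N - m adds at n.+1. *)
pose v (m n : nat) := z ^+ n.+1 * q ^ (m%:Z ^+ 2 + n%:Z ^+ 2 + n%:Z - 2 * m%:Z + 2 * N)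
  * qbin (N - 1 - m%:Z) n%:Z (q ^+ 2) * qbin n.+1%:Z m%:Z (q ^+ 2).
have v0 m n : N - 1 < m%:Z + n%:Z -> v m n = 0.
  by move=> h; rewrite /v qbin_small ?mulr0 ?mul0r //; lia.
transitivity (rhs_poly M (N - 1) + \sum_(m < M.+1) \sum_(n < M.+1) v m n).
  rewrite /rhs_poly -big_split; apply: eq_bigr => m _ /=.
  apply: (@sum_split_shift _ M (rhs_term N m) (rhs_term (N - 1) m) (v m)).
  (* At [n = 0] only [m = 0] contributes, and there [1 <= N] keeps both tops nonnegative. *)
  - rewrite /rhs_term.
    case: (nat_of_ord m) => [|m']; last by rewrite [qbin 0 _ _]qbin_small ?mulr0 //; lia.
    by congr (_ * _); rewrite !qbin0 //; try exact: expX_neq1; lia.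
  - move=> n; rewrite /rhs_term /v qbin_pascal; last exact: expX_neq1.
    rewrite mulrDr mulrDl; congr (_ + _); first by congr (_ * qbin _ _ _ * _); lia.
    rewrite (exprnP q 2) exprz_exp mulrA (exprnP q (_ + _)%N).
    rewrite -[z ^+ _ * _ * q ^ _]mulrA -expfzDr //.
    by congr (_ * q ^ _ * qbin _ _ _ * _); lia.
  - by rewrite v0 //; lia.
congr (_ + _); rewrite /rhs_poly exchange_big [X in _ = _ * X + _]exchange_big
  [X in _ = _ + _ * X]exchange_big /= !mulr_sumr -big_split /=.
apply: eq_bigr => n _; rewrite !mulr_sumr.
(* The factor [q ^ (2 m)] of the second rule cancels the [- 2 m] in [v]; in the other part [m + 1]
   turns [m^2 - 2 m] into [m^2 - 1], whence [2 * N - 1]. *)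
apply: (@sum_split_shift _ M (v ^~ n)
  (fun m => z * q ^ (2 * N) * rhs_term (N - 1) m n)
  (fun m => z * q ^ (2 * N - 1) * rhs_term (N - 2) m n)).
- rewrite /v /rhs_term; apply: regroup.
  + by rewrite exprS.
  + by rewrite (exprnP q) -expfzDr //; congr (q ^ _); lia.
  + by congr (qbin _ _ _); lia.
  + by rewrite !qbin0 //; exact: expX_neq1.
- move=> m; rewrite /v /rhs_term qbin_pascal'; last exact: expX_neq1.
  rewrite mulrDr; congr (_ + _).
    rewrite [LHS]mulrACA -[LHS]mulrA [_ ^+ m.+1 * (_ * _)]mulrA [LHS]mulrA.
    apply: shift_regroup.
    + by rewrite exprS.
    + by rewrite -exprM !(exprnP q) -!expfzDr //; congr (q ^ _); lia.
    + by congr (qbin _ _ _); lia.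
    + by congr (qbin _ _ _); lia.
  apply: regroup.
  + by rewrite exprS.
  + by rewrite (exprnP q) -expfzDr //; congr (q ^ _); lia.
  + by congr (qbin _ _ _); lia.
  + by congr (qbin _ _ _); lia.
- by rewrite rhs_term0 ?mulr0 //; lia.
Qed.

Lemma rhs_poly_lt0 M N : N < 0 -> rhs_poly M N = 0.
Proof.
move=> N0; rewrite /rhs_poly !big1 // => m _.
by rewrite big1 // => k _; rewrite rhs_term0 //; lia.
Qed.

Lemma rhs_poly_eq0 M : rhs_poly M 0 = 1.
Proof.
rewrite /rhs_poly big_ord_recl big_ord_recl /= !big1 ?addr0; first last.
- by move=> k _; rewrite rhs_term0 //= /bump; lia.
- by move=> m _; rewrite big1 // => k _; rewrite rhs_term0 //= /bump; lia.
rewrite /rhs_term /= !qbin0 //; try exact: expX_neq1; try lia.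
by rewrite !expr0 !mulr1.
Qed.

(** * Comparison of the two sides *)

Lemma lhs_poly_eq_rhs_poly M K (N : nat) : (N <= M)%N -> (N <= K)%N ->
  lhs_poly M K N%:Z = rhs_poly M N%:Z.
Proof.
elim/ltn_ind: N => -[|[|N]] IH NM NK.
- by rewrite rhs_poly_eq0 /lhs_poly lhs_sum_eq0 // lhs_sum_lt0 // mulr0 addr0.
- rewrite rhs_poly_rec //.
  rewrite subrr rhs_poly_eq0 rhs_poly_lt0 // mulr0 addr0 mulr1.
  (* [lhs_poly_rec] starts at 2, so the value [1 + z q^2] at 1 is computed directly; the remainder
     has second top [-1] and vanishes. *)
  have e : lhs_sum M K (2 * 1) 1 0 0
      = lhs_sum M K (2 * 1) 0 0 0 + z ^+ 2 * q ^ 2 * lhs_sum M K (-2) (-1) 0 0.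
    by apply: lhs_sum_pascal_q4; lia.
  by rewrite /lhs_poly e subrr !lhs_sum_eq0 // lhs_sum_lt0 // mulr0 addr0 mulr1.
rewrite lhs_poly_rec 1?rhs_poly_rec; try lia.
have -> : N.+2%:Z - 1 = N.+1%:Z by lia.
have -> : N.+2%:Z - 2 = N%:Z by lia.
by rewrite !IH //; lia.
Qed.

(** The range of [n] has even length, so both parities run over [k <= K]. *)
Lemma lhs_polyE K (N : int) : N <= K%:Z ->
  lhs_poly K.*2.+1 K N
  = \sum_(m < K.*2.+2) \sum_(n < K.*2.+2)
      z ^+ (m + n) * q ^+ L m n * qbin (2 * N - 2 * m%:Z - 2 * n%:Z) m%:Z q
      * qbin (N - m%:Z - n%:Z + (n./2)%:Z) (n./2)%:Z (q ^+ 4).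
Proof.
move=> NK; rewrite /lhs_poly /lhs_sum !mulr_sumr -big_split /=; apply: eq_bigr => m _.
move: (nat_of_ord m) => {}m; rewrite -doubleS.
rewrite (@sum_parity _ K.+1 (fun n => z ^+ (m + n) * q ^+ L m n
  * qbin (2 * N - 2 * m%:Z - 2 * n%:Z) m%:Z q
  * qbin (N - m%:Z - n%:Z + (n./2)%:Z) (n./2)%:Z (q ^+ 4))).
congr (_ + _); last rewrite mulr_sumr.
  apply: eq_bigr => k _; rewrite /lhs_term doubleK mul2n.
  congr (_ * _ * qbin _ _ _ * qbin _ _ _); try lia.
  rewrite exprnP L_bin; congr (q ^ _); lia.
apply: eq_bigr => k _; rewrite /lhs_term; symmetry; apply: regroup.
- by rewrite -exprS; congr (z ^+ _); lia.
- by rewrite !exprnP -!expfzDr //; congr (q ^ _); rewrite L_bin; lia.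
- by congr (qbin _ _ _); lia.
- by congr (qbin _ _ _); lia.
Qed.

End Recurrences.

(** * The weighted identity and its specialisations *)

(** [N] is an integer because the second identity at 0 calls for [N = -1], where both sides are
    0. *)
Lemma finite_identity (F : fieldType) (q z : F) (K : nat) (N : int) :
  (forall k : nat, (0 < k)%N -> q ^+ k != 1) -> N <= K%:Z ->
  \sum_(m < K.*2.+2) \sum_(n < K.*2.+2)
     z ^+ (m + n) * q ^+ L m n * qbin (2 * N - 2 * m%:Z - 2 * n%:Z) m%:Z q
     * qbin (N - m%:Z - n%:Z + (n./2)%:Z) (n./2)%:Z (q ^+ 4)
  = \sum_(m < K.*2.+2) \sum_(n < K.*2.+2)
     z ^+ n * q ^+ (m ^ 2 + n ^ 2 + n) * qbin (N - m%:Z) n%:Z (q ^+ 2)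
     * qbin n%:Z m%:Z (q ^+ 2).
Proof.
move=> hq NK; have hX := @expX_neq1 F q hq.
have [q0|q0] := eqVneq q 0; last first.
  rewrite -lhs_polyE // -/(rhs_poly q z K.*2.+1 N).
  case: N NK => [N NK|N _]; first by apply: lhs_poly_eq_rhs_poly => //; lia.
  by rewrite rhs_poly_lt0 // /lhs_poly !lhs_sum_lt0 ?mulr0 ?addr0 //; lia.
apply: eq_bigr => m _; apply: eq_bigr => n _.
move: (nat_of_ord m) (nat_of_ord n) => {}m {}n.
have [/andP[/eqP-> /eqP->]|mn] := boolP ((m == 0%N) && (n == 0%N)).
  rewrite !expr0 /L /= !mul1r.
  have [N0|N0] := boolP (N < 0).
    rewrite [qbin (2 * N - _ - _) _ _]qbin_small; last by lia.
    by rewrite [qbin (N - _) _ _]qbin_small ?mul0r //; lia.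
  by rewrite !qbin0 //; try exact: hX; lia.
have e1 : L m n != 0%N by rewrite /L; lia.
have e2 : (m ^ 2 + n ^ 2 + n != 0)%N by lia.
by rewrite q0 !expr0n (negbTE e1) (negbTE e2) !mulr0 !mul0r.
Qed.

Theorem theorem4p5 (F : fieldType) (q : F)
    (hq : forall k : nat, (0 < k)%N -> q ^+ k != 1) (N : nat) :
  (\sum_(x \in [set: nat * nat])
     (let (m, n) := x in
      q ^+ L m n
      * qbin (2 * N%:Z - 2 * m%:Z - 2 * n%:Z) m%:Z q
      * qbin (N%:Z - m%:Z - n%:Z + (n./2)%:Z) (n./2)%:Z (q ^+ 4))
   = \sum_(x \in [set: nat * nat])
     (let (m, n) := x in
      q ^+ (m ^ 2 + n ^ 2 + n)%N
      * qbin (N%:Z - m%:Z) n%:Z (q ^+ 2)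
      * qbin n%:Z m%:Z (q ^+ 2)))
  /\
  (\sum_(x \in [set: nat * nat])
     (let (m, n) := x in
      q ^+ (L m n + 2 * m + 2 * n + 1)%N
      * qbin (2 * N%:Z - 2 * m%:Z - 2 * n%:Z - 2) m%:Z q
      * qbin (N%:Z - m%:Z - n%:Z - 1 + (n./2)%:Z) (n./2)%:Z (q ^+ 4))
   = \sum_(x \in [set: nat * nat])
     (let (m, n) := x in
      q ^+ (m ^ 2 + n ^ 2 + 3 * n + 1)%N
      * qbin (N%:Z - m%:Z - 1) n%:Z (q ^+ 2)
      * qbin n%:Z m%:Z (q ^+ 2))).
Proof.
split.
  (* All summands with [m + n > N] vanish; the larger cut-off matches [finite_identity] at
     [K = N]. *)
  rewrite !(@sum_natnatE _ N.*2.+1) /=; first last.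
  - by move=> m n h; apply: lhs_summand0; lia.
  - by move=> m n h; apply: rhs_summand0; lia.
  have h := @finite_identity F q 1 N N%:Z hq (Order.POrderTheory.lexx _).
  by apply: etrans (etrans h _); apply: eq_bigr => m _; apply: eq_bigr => n _;
    rewrite expr1n mul1r.
rewrite !(@sum_natnatE _ N.*2.+1) /=; first last.
- move=> m n h.
  rewrite [X in qbin X (n./2)%:Z](_ : _ = N%:Z - 1 - m%:Z - n%:Z + (n./2)%:Z); last lia.
  by apply: lhs_summand0; lia.
- move=> m n h; rewrite [X in qbin X n%:Z](_ : _ = N%:Z - 1 - m%:Z); last by lia.
  by apply: rhs_summand0; lia.
have leN : N%:Z - 1 <= N%:Z by lia.
have := congr1 ( *%R q) (@finite_identity F q (q ^+ 2) N (N%:Z - 1) hq leN).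
rewrite !mulr_sumr => h; apply: etrans (etrans h _);
  apply: eq_bigr => m _ /=; rewrite mulr_sumr; apply: eq_bigr => n _ /=.
  rewrite !mulrA -exprM -exprS -exprD; congr (q ^+ _ * qbin _ _ _ * qbin _ _ _); lia.
rewrite !mulrA -exprM -exprS -exprD; congr (q ^+ _ * qbin _ _ _ * _); lia.
Qed.
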